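(* Let $G$ be a graph with $\Delta(G)=3$ and $\chi'(G)=3$, and let $k<3$. If every partial $3$-edge coloring of at most $k$ edges of $G$ is extendable to a proper $3$-edge coloring of $G$, then every partial $4$-edge coloring of at most $k+1$ edges of $G \square K_2$ is extendable to a proper $4$-edge coloring of $G\square K_2$.
   Context: $G \square H$ denotes the cartesian product; $\Delta(G)$ is the maximum degree and $\chi'(G)$ the chromatic index (a Class 1 graph is one with $\chi'(G)=\Delta(G)$). A partial $t$-edge coloring is a proper edge coloring of some subset of the edges using colors from $\{1,\dots,t\}$; it is extendable if some proper edge coloring with colors $\{1,\dots,t\}$ agrees with it on all colored edges. *)

(* Defs.v *)
From HB Require Import structures.
From mathcomp Require Import all_boot.

Set Implicit Arguments.
Unset Strict Implicit.
Unset Printing Implicit Defensive.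

(* Finite simple graphs. *)
Record sgraph := SGraph {
  vertex :> finType;
  adj : rel vertex;
  adj_sym : symmetric adj;
  adj_irrefl : irreflexive adj
}.

(* An edge is the two-element set of its ends. *)
Definition edges (G : sgraph) : {set {set G}} :=
  [set [set x; y] | x in G, y in G & adj x y].

Definition degree (G : sgraph) (x : G) : nat := #|[set y | adj x y]|.

Definition max_degree (G : sgraph) : nat := \max_(x : G) degree x.

Section CompleteGraph.
Variable n : nat.

Definition complete_adj : rel 'I_n := fun x y => x != y.

Lemma complete_adj_sym : symmetric complete_adj.
Proof. by move=> x y; rewrite /complete_adj eq_sym. Qed.

Lemma complete_adj_irrefl : irreflexive complete_adj.
Proof. by move=> x; rewrite /complete_adj eqxx. Qed.

Definition complete_graph : sgraph :=
  SGraph complete_adj_sym complete_adj_irrefl.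
End CompleteGraph.

Section CartesianProduct.
Variables G H : sgraph.

Definition cart_adj : rel (G * H) := fun p q =>
  ((p.1 == q.1) && adj p.2 q.2) || ((p.2 == q.2) && adj p.1 q.1).

Lemma cart_adj_sym : symmetric cart_adj.
Proof.
move=> p q; rewrite /cart_adj (eq_sym p.1) (eq_sym p.2).
by rewrite (adj_sym p.1) (adj_sym p.2).
Qed.

Lemma cart_adj_irrefl : irreflexive cart_adj.
Proof. by move=> p; rewrite /cart_adj !adj_irrefl !andbF. Qed.

Definition cart_prod : sgraph := SGraph cart_adj_sym cart_adj_irrefl.
End CartesianProduct.

Section EdgeColoring.
Variables (G : sgraph) (t : nat).

(* The t colors 1, ..., t are represented by 'I_t; the value None means that
   the edge is uncolored. Sets of vertices that are not edges must be mapped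
   to None (see partial_edge_coloring). *)
Implicit Types phi psi : {ffun {set G} -> option 'I_t}.

Definition colored phi : {set {set G}} := [set e | phi e != None].

Definition partial_edge_coloring phi : bool :=
  (colored phi \subset edges G) &&
  [forall e in colored phi, forall f in colored phi,
     (e != f) && ~~ [disjoint e & f] ==> (phi e != phi f)].

Definition proper_edge_coloring phi : bool :=
  partial_edge_coloring phi && (colored phi == edges G).

Definition extendable phi : bool :=
  [exists psi : {ffun {set G} -> option 'I_t},
     proper_edge_coloring psi && [forall e in colored phi, psi e == phi e]].

Definition edge_colorable : bool :=
  [exists psi : {ffun {set G} -> option 'I_t}, proper_edge_coloring psi].
End EdgeColoring.

Lemma edge_colorable_ex (G : sgraph) : exists t, edge_colorable G t.
Proof.
exists #|{set G}|; apply/existsP.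
exists [ffun e => if e \in edges G then Some (enum_rank e) else None].
have domE : colored [ffun e => if e \in edges G then Some (enum_rank e)
                               else None] = edges G.
  by apply/setP=> e; rewrite inE ffunE; case: ifP.
rewrite /proper_edge_coloring /partial_edge_coloring domE subxx eqxx andbT.
apply/forall_inP=> e eE; apply/forall_inP=> f fE; apply/implyP=> /andP[nef _].
rewrite !ffunE eE fE; apply: contra_neq nef => -[] /enum_rank_inj; exact.
Qed.

Definition chromatic_index (G : sgraph) : nat := ex_minn (edge_colorable_ex G).

(* Main.v *)
(** Fix a base color [B]. Colouring both copies of [G] with the three other
    colors and every matching edge [B] is proper, and whenever the two copies
    of an edge [xy] receive the same color [c], the 4-cycle over [xy] is
    bichromatic, so [B] and [c] may be exchanged on it; this can be done
    simultaneously over any matching of [G]. A prescribed color [c] on the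
    matching edge at [v] is obtained by exchanging over the edge of color [c]
    at [v], or directly if [c] is missing at [v] in both copies.

    The base color is chosen among the prescribed ones whenever possible, so
    that at most [k] edges remain to be precolored in [G]; edges left over are
    precolored so as to keep the exchanged 4-cycles away from one another and
    from the other prescribed edges. For [k = 2] the hypothesis on [G] excludes
    triangles with a vertex of degree 3, where this would fail. *)
Require Import Defs.
From mathcomp Require Import all_boot.

Set Implicit Arguments.
Unset Strict Implicit.
Unset Printing Implicit Defensive.

(** * Edge colorings as symmetric functions of two vertices *)

(** Only the values on adjacent pairs carry meaning, so colorings can be defined by cases on
    vertices, without options or sets of edges. Symmetry, however, is asked of all pairs. *)
Definition proper_fun (H : sgraph) (T : eqType) (h : H -> H -> T) : Prop :=
  (forall x y, h x y = h y x) /\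
  (forall x y z, adj x y -> adj x z -> h x y = h x z -> y = z).

Lemma pair_setE (T : finType) (x y x' y' : T) :
  ([set x; y] == [set x'; y']) =
  (x == x') && (y == y') || (x == y') && (y == x').
Proof.
apply/eqP/orP=> [E|[]/andP[/eqP-> /eqP->] //]; last by rewrite setUC.
have: x \in [set x'; y'] by rewrite -E !inE eqxx.
have: y \in [set x'; y'] by rewrite -E !inE eqxx orbT.
have: x' \in [set x; y] by rewrite E !inE eqxx.
have: y' \in [set x; y] by rewrite E !inE eqxx orbT.
rewrite !inE ![x' == _]eq_sym ![y' == _]eq_sym.
by case: (x == x'); case: (x == y'); case: (y == x'); case: (y == y'); auto.
Qed.

Lemma pair_set_disjoint (T : finType) (x y x' y' : T) :
  [disjoint [set x; y] & [set x'; y']] =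
  ~~ [|| x == x', x == y', y == x' | y == y'].
Proof.
by rewrite disjoints_subset subUset !sub1set !inE !negb_or !andbA.
Qed.

Lemma in_edges (H : sgraph) (x y : H) : ([set x; y] \in edges H) = adj x y.
Proof.
apply/imset2P/idP => [[u v _]|xy]; last by exists x y; rewrite ?inE.
rewrite !inE /= => uv /eqP; rewrite pair_setE.
by case/orP=> /andP[/eqP-> /eqP->]; rewrite // adj_sym.
Qed.

Lemma edgesP (H : sgraph) (e : {set H}) :
  reflect (exists x y, adj x y /\ e = [set x; y]) (e \in edges H).
Proof.
apply: (iffP idP) => [/imset2P[x y _]|[x [y [xy ->]]]]; last by rewrite in_edges.
by rewrite !inE /= => xy ->; exists x, y.
Qed.

Lemma adj_neq (H : sgraph) (x y : H) : adj x y -> x != y.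
Proof. by apply: contraTneq => ->; rewrite adj_irrefl. Qed.

Lemma proper_fun_of_extendable (H : sgraph) t
    (phi : {ffun {set H} -> option 'I_t.+1}) :
  extendable phi ->
  exists2 h : H -> H -> 'I_t.+1, proper_fun h &
    forall x y c, phi [set x; y] = Some c -> h x y = c.
Proof.
case/existsP=> psi /andP[/andP[/andP[_ /forall_inP pr] /eqP dom] /forall_inP ext].
(* The default [ord0] is reached only on pairs that are not edges; the palette is ['I_t.+1] so that
   it exists. *)
exists (fun x y => odflt ord0 (psi [set x; y])).
  split=> [x y|x y z xy xz E]; first by rewrite setUC.
  have cxy : [set x; y] \in colored psi by rewrite dom in_edges.
  have cxz : [set x; z] \in colored psi by rewrite dom in_edges.
  apply/eqP; apply: contraT => nyz.
  have /forall_inP/(_ _ cxz)/implyP := pr _ cxy.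
  rewrite pair_setE pair_set_disjoint eqxx /= (negPf nyz) /=.
  have /negPf-> /= : ~~ ((x == z) && (y == x)) by rewrite negb_and adj_neq.
  move=> /(_ isT) /eqP[]; move: cxy cxz E; rewrite !inE.
  by case: (psi _) => // a _; case: (psi _) => // b _ /= ->.
move=> x y c E.
have : [set x; y] \in colored phi by rewrite inE E.
by move/ext; rewrite E => /eqP ->.
Qed.

Lemma extendable_of_proper_fun (H : sgraph) t
    (phi : {ffun {set H} -> option 'I_t}) (h : H -> H -> 'I_t) :
  proper_fun h -> colored phi \subset edges H ->
  (forall x y c, phi [set x; y] = Some c -> h x y = c) ->
  extendable phi.
Proof.
move=> [hs hp] /subsetP domphi hphi.
(* By symmetry of [h], the picked color does not depend on how the edge is written as a pair. *)
pose psi := [ffun e : {set H} =>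
  [pick c | [exists x, exists y, [&& adj x y, e == [set x; y] & h x y == c]]]].
have psiE x y : adj x y -> psi [set x; y] = Some (h x y).
  move=> xy; rewrite ffunE; case: pickP => [c|]; last first.
    by move/(_ (h x y)) => /existsP[]; exists x; apply/existsP; exists y;
       rewrite xy !eqxx.
  case/existsP=> u /existsP[v /and3P[uv]]; rewrite pair_setE.
  by case/orP=> /andP[/eqP-> /eqP->] /eqP<-; rewrite // hs.
have dom : colored psi = edges H.
  apply/setP=> e; rewrite inE; apply/idP/edgesP => [|[x [y [xy ->]]]]; last first.
    by rewrite psiE.
  rewrite ffunE; case: pickP => // c /existsP[x /existsP[y /and3P[xy /eqP-> _]]] _.
  by exists x, y.
apply/existsP; exists psi; rewrite /proper_edge_coloring dom eqxx andbT.
apply/andP; split; last first.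
  apply/forall_inP => e ce; have /edgesP[x [y [xy eE]]] := domphi _ ce.
  move: ce; rewrite inE eE psiE //; case E: (phi _) => [c|] // _.
  by rewrite (hphi _ _ _ E).
rewrite /partial_edge_coloring dom subxx /=.
apply/forall_inP=> _ /edgesP[x [y [xy ->]]].
apply/forall_inP=> _ /edgesP[u [v [uv ->]]].
apply/implyP=> /andP[]; rewrite pair_set_disjoint negbK !psiE //.
move=> ne sh; apply: contraNneq ne => -[E].
rewrite pair_setE; case/or4P: sh => /eqP e; subst.
- by rewrite eqxx (hp _ _ _ xy uv E) eqxx.
- by rewrite (hp v y u) ?eqxx ?orbT // 1?adj_sym // E hs.
- by rewrite (hp u x v) ?eqxx ?orbT // 1?adj_sym // -E hs.
- by rewrite (hp v x u) ?eqxx // 1?adj_sym // hs E hs.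
Qed.

(** * Lists of precolored edges and the extension hypothesis *)

Section Items.
Variable G : sgraph.
Notation item := (G * G * 'I_4)%type.

Definition same (p q : G * G) : bool :=
  (p.1 == q.1) && (p.2 == q.2) || (p.1 == q.2) && (p.2 == q.1).

Definition share (p q : G * G) : bool :=
  [|| p.1 == q.1, p.1 == q.2, p.2 == q.1 | p.2 == q.2].

(** Lists may name an edge twice, possibly with its ends exchanged, in particular when the lists of
    the two copies are concatenated; such repetitions are harmless as long as the colors agree. *)
Definition compat (i j : item) : bool :=
  if same i.1 j.1 then i.2 == j.2 else share i.1 j.1 ==> (i.2 != j.2).

Lemma same_sym p q : same p q = same q p.
Proof.
by rewrite /same ![q.1 == _]eq_sym ![q.2 == _]eq_sym [_ && (p.1 == _)]andbC.
Qed.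

Lemma share_sym p q : share p q = share q p.
Proof.
rewrite /share ![q.1 == _]eq_sym ![q.2 == _]eq_sym.
by congr (_ || _); rewrite orbCA.
Qed.

Lemma compat_sym i j : compat i j = compat j i.
Proof.
by rewrite /compat same_sym share_sym [_ == i.2]eq_sym.
Qed.

Lemma compat_refl i : compat i i.
Proof. by rewrite /compat /same !eqxx. Qed.

Definition avoids (f : G -> G -> 'I_4) (B : 'I_4) : Prop :=
  forall x y, adj x y -> f x y != B.

(* A proper 3-edge coloring is represented by one with colors in ['I_4] that
   avoids a base color [B]; items that are not edges impose no constraint. *)
Definition extension_property (k : nat) : Prop :=
  forall (B : 'I_4) (s : seq item), size s <= k ->
    {in s, forall i, i.2 != B} ->
    {in s &, forall i j, adj i.1.1 i.1.2 -> adj j.1.1 j.1.2 -> compat i j} ->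
    exists f, [/\ proper_fun f, avoids f B &
      {in s, forall i, adj i.1.1 i.1.2 -> f i.1.1 i.1.2 = i.2}].

(** The three colors other than [B] are identified with ['I_3] through [lift B] and [unlift B].
    Repeated items color a single edge, so a list of length at most [k] colors at most [k] edges. *)
Lemma extension_propertyI k :
  (forall phi : {ffun {set G} -> option 'I_3},
     partial_edge_coloring phi -> #|colored phi| <= k -> extendable phi) ->
  extension_property k.
Proof.
move=> hyp B s0 sk0 sB0 sc0.
pose s := [seq i <- s0 | adj i.1.1 i.1.2].
have ss0 i : i \in s -> i \in s0 /\ adj i.1.1 i.1.2.
  by rewrite mem_filter => /andP[].
have sk : size s <= k by rewrite (leq_trans _ sk0) // size_filter count_size.
have sc : {in s &, forall i j, compat i j}.
  by move=> i j /ss0[? ?] /ss0[? ?]; apply: sc0.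
pose eset (i : item) := [set i.1.1; i.1.2].
(* The first item on an edge decides its color; by compatibility any other item on it would give the
   same. *)
pose phi : {ffun {set G} -> option 'I_3} := [ffun e : {set G} =>
  if [seq i <- s | eset i == e] is i :: _ then unlift B i.2 else None].
have phi_some (e : {set G}) c : phi e = Some c ->
    exists2 i, i \in s & eset i = e /\ i.2 = lift B c.
  rewrite ffunE; case E: [seq _ <- _ | _] => [|i r] // U.
  have : i \in [seq i <- s | eset i == e] by rewrite E mem_head.
  rewrite mem_filter => /andP[/eqP ie si]; exists i => //; split=> //.
  by move: U; case: unliftP => // j -> [->].
have phi_item (i : item) : i \in s -> phi (eset i) = unlift B i.2.
  move=> si; rewrite ffunE; case E: [seq _ <- _ | _] => [|j r].
    have : i \in [seq j <- s | eset j == eset i] by rewrite mem_filter eqxx.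
    by rewrite E.
  have : j \in [seq j <- s | eset j == eset i] by rewrite E mem_head.
  rewrite mem_filter => /andP[eji sj]; have := sc _ _ sj si.
  by rewrite /compat /same -pair_setE eji => /eqP ->.
have dom : colored phi \subset [seq eset i | i <- s].
  apply/subsetP=> e; rewrite inE; case E: (phi e) => [c|] // _.
  by have [i si [<- _]] := phi_some _ _ E; apply: map_f.
have cphi : #|colored phi| <= k.
  rewrite (leq_trans (subset_leq_card dom)) // (leq_trans (card_size _)) //.
  by rewrite size_map.
have pphi : partial_edge_coloring phi.
  apply/andP; split.
    apply/subsetP=> e /(subsetP dom)/mapP[i /ss0[_ ai] ->].
    by rewrite in_edges.
  apply/forall_inP=> e; rewrite inE; case E: (phi e) => [c|] // _.
  apply/forall_inP=> f; rewrite inE; case F: (phi f) => [d|] // _.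
  have [i si [ie ic]] := phi_some _ _ E; have [j sj [jf jd]] := phi_some _ _ F.
  apply/implyP=> /andP[nef]; rewrite -ie -jf pair_set_disjoint negbK => sh.
  have := sc _ _ si sj; rewrite /compat /same /share sh -pair_setE.
  rewrite -/(eset i) -/(eset j) ie jf (negPf nef) ic jd /=.
  by apply: contra_neq => -[->].
have [h [hs hp] hphi] := proper_fun_of_extendable (hyp _ pphi cphi).
exists (fun x y => lift B (h x y)); split.
- split=> [x y|x y z xy xz /lift_inj]; [by rewrite hs|exact: hp].
- by move=> x y _; rewrite eq_sym neq_lift.
move=> i i0 ai; have si : i \in s by rewrite mem_filter ai.
have := phi_item _ si; have := sB0 _ i0.
case: unliftP => [c -> _ E|->]; last by rewrite eqxx.
by rewrite (hphi _ _ _ E).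
Qed.

(* Colors of the two copies of [G] and of the matching edges of the prism over [G]. *)
Definition fits (f g : G -> G -> 'I_4) (m : G -> 'I_4) : Prop :=
  [/\ proper_fun f, proper_fun g &
      forall x y, adj x y -> m x != f x y /\ m x != g x y].

(** * Exchanging colors over a matching *)

(** Since [f] never uses [B] and [S] is a matching, the new [B]-edges cannot meet one another or an
    old [B]-edge. *)
Lemma proper_swap (f : G -> G -> 'I_4) B (S : rel G) :
  proper_fun f -> avoids f B -> symmetric S ->
  (forall x y z, S x y -> S x z -> y = z) ->
  proper_fun (fun x y => if S x y then B else f x y).
Proof.
move=> [fs fp] fB Ss Su; split=> [x y|x y z xy xz]; first by rewrite Ss fs.
case Sy: (S x y); case Sz: (S x z).
- by move=> _; apply: Su Sy Sz.
- by move=> E; have := fB _ _ xz; rewrite -E eqxx.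
- by move=> E; have := fB _ _ xy; rewrite E eqxx.
- exact: fp.
Qed.

(* For each [S x y], the colors [B] and [f x y] are exchanged on the 4-cycle
   over [xy]. *)
Lemma swap_coloring (f g : G -> G -> 'I_4) (m0 : G -> 'I_4) B (S : rel G) :
  proper_fun f -> proper_fun g -> avoids f B -> avoids g B ->
  symmetric S -> (forall x y, S x y -> adj x y) ->
  (forall x y z, S x y -> S x z -> y = z) ->
  (forall x y, S x y -> f x y = g x y) ->
  (forall x y, adj x y -> (forall z, ~~ S x z) -> m0 x != f x y /\ m0 x != g x y) ->
  exists m, [/\ fits (fun x y => if S x y then B else f x y)
                     (fun x y => if S x y then B else g x y) m,
                forall x y, S x y -> m x = f x y &
                forall x, (forall y, ~~ S x y) -> m x = m0 x].
Proof.
move=> pf pg fB gB Ss Sa Su Sfg mm.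
(* A matched vertex passes the old color of its matching edge to its rung; this differs from the
   colors of its other edges because [f] and [g] are proper. *)
exists (fun x => if [pick y | S x y] is Some y then f x y else m0 x).
split; last first.
- by move=> x N; case: pickP => // y; rewrite (negPf (N y)).
- by move=> x y xy; case: pickP => [z xz|/(_ y)]; rewrite ?xy // (Su _ _ _ xy xz).
split; try exact: proper_swap.
move=> x y xy; case: pickP => [z xz|N]; last first.
  by rewrite N; apply: mm => // z; rewrite N.
case Sy: (S x y); first by rewrite Sfg // !(gB, fB) //; apply: Sa.
have nyz : z != y by apply: contraFneq Sy => <-.
split; first by apply: contra_neq nyz; case: pf => _; apply; auto.
by rewrite Sfg //; apply: contra_neq nyz; case: pg => _; apply; auto.
Qed.

(** * Prescriptions on the prism; rungs of a single color; target vertices *)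

Definition coverable (Ms : seq (G * 'I_4)) (E0 E1 : seq item) : Prop :=
  exists f g m, [/\ fits f g m, {in Ms, forall i, m i.1 = i.2},
    {in E0, forall i, f i.1.1 i.1.2 = i.2} &
    {in E1, forall i, g i.1.1 i.1.2 = i.2}].

(** Properness of the prescribed colors in the prism. Nothing relates [E0] to [E1], because edges of
    different copies have no common end. *)
Definition admissible (Ms : seq (G * 'I_4)) (E0 E1 : seq item) : Prop :=
  [/\ {in Ms &, forall i j, i.1 = j.1 -> i.2 = j.2},
      {in E0 ++ E1, forall i, adj i.1.1 i.1.2},
      {in E0 &, forall i j, compat i j}, {in E1 &, forall i j, compat i j} &
      forall i j, i \in Ms -> j \in E0 ++ E1 ->
        (i.1 == j.1.1) || (i.1 == j.1.2) -> i.2 != j.2].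

Lemma coverableC Ms E0 E1 : coverable Ms E0 E1 -> coverable Ms E1 E0.
Proof.
case=> f [g [m [[pf pg h] hM h0 h1]]]; exists g, f, m; split=> //; split=> // x y xy.
by have [] := h _ _ xy.
Qed.

Lemma admissibleC Ms E0 E1 : admissible Ms E0 E1 -> admissible Ms E1 E0.
Proof.
case=> h1 h2 h3 h4 h5; split=> // [i|i j iM].
  by rewrite mem_cat orbC -mem_cat; apply: h2.
by rewrite mem_cat orbC -mem_cat; apply: h5.
Qed.

Lemma sameP p x y : reflect (p = (x, y) \/ p = (y, x)) (same p (x, y)).
Proof.
case: p => u v; rewrite /same /= -!xpair_eqE.
by apply: (iffP orP) => -[] /eqP; auto.
Qed.

Lemma same_share p q : same p q -> share p q.
Proof. by rewrite /same /share => /orP[] /andP[-> ->]; rewrite ?orbT. Qed.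

Lemma same_color i j : same i.1 j.1 -> compat i j -> i.2 = j.2.
Proof. by rewrite /compat => -> /eqP. Qed.

(* The edges of the base color [a] are obtained by swapping, hence only the
   others count against [k]. *)
Lemma swap_coverable k a Ms E0 E1 :
  extension_property k -> admissible Ms E0 E1 -> {in Ms, forall i, i.2 = a} ->
  {in E0 ++ E1 &, forall i j, compat i j} ->
  count (fun i => i.2 != a) (E0 ++ E1) <= k -> coverable Ms E0 E1.
Proof.
move=> ext [_ Eadj _ _ ME] Ma Ec ck.
have [|||f [pf fa fE]] := ext a [seq i <- E0 ++ E1 | i.2 != a].
- by rewrite size_filter.
- by move=> i; rewrite mem_filter => /andP[].
- move=> i j; rewrite !mem_filter => /andP[_ iE] /andP[_ jE] _ _; exact: Ec.
have [fs _] := pf.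
(* Joint compatibility makes the prescribed edges of color [a] a matching of [G]. The exchange
   recolors both copies, which does no harm: an item of the other copy on the same edge must also
   have color [a]. *)
pose S x y := has (fun i : item => (i.2 == a) && same i.1 (x, y)) (E0 ++ E1).
have Ss : symmetric S.
  by move=> x y; apply: eq_has => i; rewrite /same /= orbC.
have Sa x y : S x y -> adj x y.
  case/hasP=> i /Eadj ai /andP[_ /sameP[] E]; move: ai; rewrite E //=.
  by rewrite adj_sym.
have Su x y z : S x y -> S x z -> y = z.
  move=> xy xz; have /adj_neq nxz := Sa _ _ xz.
  move: xy xz => /hasP[i iE /andP[/eqP ia /sameP si]].
  move=> /hasP[j jE /andP[/eqP ja /sameP sj]].
  have := Ec _ _ iE jE; rewrite /compat ia ja eqxx implybF.
  have -> : share i.1 j.1.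
    by case: si => ->; case: sj => ->; rewrite /share /= eqxx ?orbT.
  case: ifP => // + _; case: si => ->; case: sj => ->; rewrite /same /=;
    by rewrite ?[_ == x]eq_sym (negPf nxz) eqxx ?andbF ?andbT ?orbF => /eqP.
have [||m [Hfit mS mN]] := swap_coloring (m0 := fun=> a) pf pf fa fa Ss Sa Su.
- by [].
- by move=> x y xy _; rewrite eq_sym fa.
have EE i : i \in E0 ++ E1 ->
    (if S i.1.1 i.1.2 then a else f i.1.1 i.1.2) = i.2.
  move=> iE; case: ifP => [/hasP[j jE /andP[/eqP <- sj]]|].
    by apply: same_color; rewrite ?(Ec _ _ jE iE) //; case: (i.1) sj.
  case: (eqVneq i.2 a) => [ia|nia _]; last first.
    by apply: fE; rewrite ?Eadj // mem_filter nia.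
  by move/negP=> []; apply/hasP; exists i; rewrite // ia /same !eqxx.
eexists; eexists; exists m; split; first exact: Hfit.
(* A prescribed rung has color [a], so by admissibility no prescribed [a]-edge ends at it and its
   color is not exchanged. *)
- move=> i iM; rewrite mN ?Ma // => y; apply/hasPn=> j jE.
  apply/negP=> /andP[/eqP ja /sameP sj]; have := ME _ _ iM jE.
  rewrite ja Ma // eqxx => H; suff /H : (i.1 == j.1.1) || (i.1 == j.1.2) by [].
  by case: sj => ->; rewrite eqxx ?orbT.
- by move=> i i0; apply: EE; rewrite mem_cat i0.
- by move=> i i0; apply: EE; rewrite mem_cat i0 orbT.
Qed.

(** With no prescribed edge of color [a], all rungs can receive [a] and the copies are extended
    independently. Thus [E0] and [E1] may conflict over [G], and the bound [k] applies to each
    separately. *)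
Lemma split_coverable k a Ms E0 E1 :
  extension_property k -> admissible Ms E0 E1 -> {in Ms, forall i, i.2 = a} ->
  {in E0 ++ E1, forall i, i.2 != a} -> size E0 <= k -> size E1 <= k ->
  coverable Ms E0 E1.
Proof.
move=> ext [_ Eadj c0 c1 _] Ma Ea k0 k1.
have sub0 i : i \in E0 -> i \in E0 ++ E1 by rewrite mem_cat => ->.
have sub1 i : i \in E1 -> i \in E0 ++ E1 by rewrite mem_cat orbC => ->.
have [|i j iE jE _ _|f [pf fa fE]] := ext a E0 k0.
- by move=> i /sub0/Ea.
- exact: c0.
have [|i j iE jE _ _|g [pg ga gE]] := ext a E1 k1.
- by move=> i /sub1/Ea.
- exact: c1.
exists f, g, (fun=> a); split.
- by split=> // x y xy; rewrite ![a == _]eq_sym fa ?ga.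
- by move=> i /Ma.
- by move=> i i0; apply: fE => //; apply/Eadj/sub0.
- by move=> i i0; apply: gE => //; apply/Eadj/sub1.
Qed.

(* At each target [(v, c)] the edge of color [c], if any, is swapped. *)
Lemma target_coloring (f g : G -> G -> 'I_4) B (T : seq (G * 'I_4)) :
  proper_fun f -> proper_fun g -> avoids f B -> avoids g B ->
  {in T &, forall s t, s.1 = t.1 -> s.2 = t.2} ->
  {in T, forall t, t.2 != B} ->
  {in T, forall t y, adj t.1 y -> (f t.1 y == t.2) = (g t.1 y == t.2)} ->
  {in T &, forall s t, adj s.1 t.1 -> f s.1 t.1 != s.2} ->
  {in T &, forall s t y, s.1 != t.1 -> adj s.1 y -> adj t.1 y ->
     f s.1 y = s.2 -> f t.1 y != t.2} ->
  exists f' g' m, [/\ fits f' g' m, {in T, forall t, m t.1 = t.2},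
    forall x, {in T, forall t, t.1 != x /\ (adj t.1 x -> f t.1 x != t.2)} -> m x = B,
    forall x y, adj x y -> {in T, forall t, t.1 = x \/ t.1 = y -> f x y != t.2} ->
      f' x y = f x y &
    forall x y, adj x y -> {in T, forall t, t.1 = x \/ t.1 = y -> g x y != t.2} ->
      g' x y = g x y].
Proof.
move=> pf pg fB gB Tf TB Tfg T1 T2; have [fs fp] := pf; have [gs gp] := pg.
pose S x y := adj x y &&
  has (fun t : G * 'I_4 => ((t.1 == x) || (t.1 == y)) && (f x y == t.2)) T.
have Ss : symmetric S.
  by move=> x y; rewrite /S adj_sym fs; congr (_ && _); apply: eq_has => t;
     rewrite orbC.
have Sa x y : S x y -> adj x y by case/andP.
have St t y : t \in T -> adj t.1 y -> f t.1 y = t.2 -> S t.1 y.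
  by move=> tT ty E; rewrite /S ty; apply/hasP; exists t; rewrite // E !eqxx.
(* Two exchanged edges meeting at [x] come from targets at [x] or at their far ends. Both at [x]:
   the colors agree. One at [x]: an edge joins two targets. Both far: [x] is a common neighbor of
   two targets. The hypotheses exclude the last two. *)
have Su x y z : S x y -> S x z -> y = z.
  move=> /andP[xy /hasP[s sT /andP[hs /eqP fsE]]].
  move=> /andP[xz /hasP[t tT /andP[ht /eqP ftE]]].
  case/orP: hs => /eqP hs; case/orP: ht => /eqP ht.
  - by apply: (fp x) => //; rewrite fsE ftE; apply: Tf; rewrite // hs ht.
  - have := T1 _ _ tT sT; rewrite hs ht fs ftE eqxx adj_sym xz.
    by move/(_ isT).
  - have := T1 _ _ sT tT; rewrite hs ht fs fsE eqxx adj_sym xy.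
    by move/(_ isT).
  - apply/eqP; apply: contraT => nyz; have := T2 _ _ sT tT x.
    rewrite hs ht nyz ![adj _ x]adj_sym xy xz ![f _ x]fs fsE ftE eqxx.
    by move/(_ isT isT isT erefl).
have Sfg x y : S x y -> f x y = g x y.
  case/andP=> xy /hasP[t tT /andP[/orP[]/eqP ht /eqP E]].
    by have := Tfg _ tT y; rewrite ht xy E eqxx => /(_ isT)/esym/eqP.
  by have := Tfg _ tT x; rewrite ht adj_sym fs gs xy E eqxx => /(_ isT)/esym/eqP.
(* A target at which its color is missing takes that color on its rung directly. *)
pose m0 x := if [seq t <- T | t.1 == x] is t :: _ then t.2 else B.
have m0E x : (exists2 t, t \in T & t.1 = x /\ m0 x = t.2) \/
             ({in T, forall t, t.1 != x} /\ m0 x = B).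
  rewrite /m0; case E: [seq _ <- _ | _] => [|t r].
    right; split=> // t tT; apply/negP=> tx.
    have : t \in [seq t <- T | t.1 == x] by rewrite mem_filter tx.
    by rewrite E.
  have : t \in [seq t <- T | t.1 == x] by rewrite E mem_head.
  by rewrite mem_filter => /andP[/eqP tx tT]; left; exists t.
have [||m [Hfit mS mN]] := swap_coloring (m0 := m0) pf pg fB gB Ss Sa Su.
- exact: Sfg.
- move=> x y xy N; case: (m0E x) => [[t tT [tx ->]]|[_ ->]]; last first.
    by rewrite ![B == _]eq_sym fB ?gB.
  have H : f x y != t.2.
    by apply: contraNneq (N y) => E; rewrite -tx; apply: St; rewrite ?tx.
  by have := Tfg _ tT y; rewrite tx ![t.2 == _]eq_sym => <-.
have NS x y : adj x y -> {in T, forall t, t.1 = x \/ t.1 = y -> f x y != t.2} ->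
    ~~ S x y.
  move=> xy H; rewrite /S xy; apply/hasPn=> t tT; rewrite negb_and -implybE.
  by apply/implyP=> /orP[]/eqP E; apply: H; auto.
eexists; eexists; exists m; split; first exact: Hfit.
- move=> t tT; case: (pickP (S t.1)) => [y Sy|N].
    rewrite (mS _ _ Sy); case/andP: Sy => ty /hasP[s sT /andP[]].
    case/orP=> /eqP E /eqP fE; first by rewrite fE; apply: Tf.
    by have := T1 _ _ sT tT; rewrite E fs fE eqxx adj_sym ty => /(_ isT).
  rewrite mN => [|y]; last by rewrite N.
  case: (m0E t.1) => [[s sT [st ->]]|[/(_ _ tT)]]; last by rewrite eqxx.
  exact: Tf.
- move=> x H; have nT y : ~~ S x y.
    apply/negP=> /andP[xy /hasP[t tT /andP[/orP[]/eqP E /eqP fE]]].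
      by have [/eqP] := H _ tT.
    by have [_] := H _ tT; rewrite E fs fE eqxx adj_sym xy => /(_ isT).
  rewrite mN //; case: (m0E x) => [[t /H[] /eqP ? _ []]|[]] //.
- by move=> x y xy /(NS _ _ xy)/negPf ->.
- move=> x y xy H /=; rewrite (negPf (NS _ _ xy _)) // => t tT txy.
  have := H _ tT txy; case: txy => E.
    by have := Tfg _ tT y; rewrite E => ->.
  by have := Tfg _ tT x; rewrite E adj_sym fs gs => ->.
Qed.

(** * Single targets and precolorings of two edges *)

Lemma fresh_color t (s : seq 'I_t) : size s < t -> exists c, c \notin s.
Proof.
move=> st; apply/existsP; rewrite -negb_forall; apply: contraL st => /forallP all_s.
rewrite -leqNgt -[t in t <= _]card_ord (leq_trans _ (card_size s)) //.
by apply/subset_leq_card/subsetP=> x _.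
Qed.

Lemma uniq_size_ord t (s : seq 'I_t) : uniq s -> size s <= t.
Proof. by move/card_uniqP <-; have := max_card (mem s); rewrite card_ord. Qed.

Lemma target1_coloring (f g : G -> G -> 'I_4) B q c :
  proper_fun f -> proper_fun g -> avoids f B -> avoids g B -> c != B ->
  (forall y, adj q y -> (f q y == c) = (g q y == c)) ->
  exists f' g' m, [/\ fits f' g' m, m q = c,
    forall x, x != q -> (adj q x -> f q x != c) -> m x = B,
    forall x y, adj x y -> (q = x \/ q = y -> f x y != c) -> f' x y = f x y &
    forall x y, adj x y -> (q = x \/ q = y -> g x y != c) -> g' x y = g x y].
Proof.
move=> pf pg fB gB cB fg.
have [||||| f' [g' [m [hfit hT hB hf hg]]]] :=
  target_coloring (T := [:: (q, c)]) pf pg fB gB.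
- by move=> s t; rewrite !inE => /eqP-> /eqP->.
- by move=> t; rewrite !inE => /eqP->.
- by move=> t; rewrite !inE => /eqP->.
- by move=> s t; rewrite !inE => /eqP-> /eqP->; rewrite adj_irrefl.
- by move=> s t; rewrite !inE => /eqP-> /eqP-> y; rewrite eqxx.
exists f', g', m; split=> //.
- by apply: (hT (q, c)); rewrite mem_head.
- move=> x xq xc; apply: hB => t; rewrite !inE => /eqP->.
  by rewrite eq_sym.
- by move=> x y xy H; apply: hf => // t; rewrite !inE => /eqP->.
- by move=> x y xy H; apply: hg => // t; rewrite !inE => /eqP->.
Qed.

Lemma compatI i j :
  (share i.1 j.1 -> ~~ same i.1 j.1 && (i.2 != j.2)) -> compat i j.
Proof.
move=> H; rewrite /compat; case: ifP => [s|_].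
  by have := H (same_share s); rewrite s.
by apply/implyP=> /H /andP[].
Qed.

Lemma compat_pair i j : compat i j -> {in [:: i; j] &, forall i j, compat i j}.
Proof.
move=> ij u v; rewrite !inE.
by case/orP=> /eqP-> /orP[] /eqP->; rewrite ?compat_refl // compat_sym.
Qed.

Lemma extend_pair k B i j :
  extension_property k -> 1 < k -> i.2 != B -> j.2 != B ->
  (adj i.1.1 i.1.2 -> adj j.1.1 j.1.2 -> compat i j) ->
  exists f, [/\ proper_fun f, avoids f B,
    adj i.1.1 i.1.2 -> f i.1.1 i.1.2 = i.2 & adj j.1.1 j.1.2 -> f j.1.1 j.1.2 = j.2].
Proof.
move=> ext k1 iB jB ij; have [//|||f [pf fB fE]] := ext B [:: i; j].
- by move=> l; rewrite !inE => /orP[] /eqP->.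
- move=> u v; rewrite !inE; case/orP=> /eqP-> /orP[] /eqP-> ai aj;
    rewrite ?compat_refl //; first exact: ij.
  by rewrite compat_sym; apply: ij.
by exists f; split=> //; apply: fE; rewrite !inE eqxx ?orbT.
Qed.

Lemma coverable_two k p b q c E :
  extension_property k -> size E <= 1 -> size E < k -> p != q -> b != c ->
  {in E, forall i, adj i.1.1 i.1.2} -> {in E, forall i, i.2 != b} ->
  {in E, forall i, (q == i.1.1) || (q == i.1.2) -> c != i.2} ->
  coverable [:: (p, b); (q, c)] E [::].
Proof.
move=> ext E1 Ek pq bc Ea Eb Ec.
have [f [pf fb fE fqp]] : exists f, [/\ proper_fun f, avoids f b,
    {in E, forall i, f i.1.1 i.1.2 = i.2} & adj q p -> f q p != c].
  have [|d] := fresh_color (s := [:: b, c & [seq i.2 | i <- E]]).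
    by rewrite /= size_map; case: (size E) E1 => [|[]].
  rewrite !inE !negb_or => /and3P[db dc dE].
  (* If [qp] is itself prescribed, its color already differs from [c], because it ends at [q]. *)
  case: (boolP (has (fun i : item => same i.1 (q, p)) E)) => [|/hasPn nE].
    case/hasP=> i iE /sameP si.
    have [||f [pf fb fE]] := ext b E (ltnW Ek); first exact: Eb.
      case: (E) E1 iE => [|j []] // _ _ u v; rewrite !inE => /eqP-> /eqP-> _ _.
      exact: compat_refl.
    exists f; split=> //; first by move=> j jE; rewrite fE ?Ea.
    have := fE _ iE (Ea _ iE); have := Ec _ iE.
    case: si => -> /=; rewrite eqxx ?orbT => /(_ isT) ci e _.
      by rewrite e eq_sym.
    by rewrite (proj1 pf) e eq_sym.
  have [//||| f [pf fb fE]] := ext b ((q, p, d) :: E).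
  - by move=> i; rewrite inE => /predU1P[->|/Eb].
  - have H i : i \in E -> compat (q, p, d) i.
      move=> iE; apply: compatI => _; rewrite same_sym nE //=.
      by apply: contraNneq dE => ->; apply: map_f.
    move=> i j; rewrite !inE => /predU1P[->|iE] /predU1P[->|jE] _ _.
    + exact: compat_refl.
    + exact: H.
    + by rewrite compat_sym H.
    + case: (E) E1 iE jE => [|l []] // _; rewrite !inE => /eqP-> /eqP->.
      exact: compat_refl.
  exists f; split=> //.
    by move=> i iE; apply: fE; rewrite ?Ea // inE iE orbT.
  by move=> qp; rewrite (fE (q, p, d)) // mem_head.
have cb : c != b by rewrite eq_sym.
have [//|f' [g' [m [hfit mq mB hf _]]]] := target1_coloring (q := q) pf pf fb fb cb.
exists f', g', m; split=> // [i|i iE].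
  by rewrite !inE => /orP[] /eqP->; rewrite //= mB.
rewrite hf ?Ea ?fE // => qi; rewrite eq_sym; apply: Ec => //.
by case: qi => <-; rewrite eqxx ?orbT.
Qed.

(** * One rung and conflicting edges in the two copies *)

(** The color [a] on [xy] keeps [a] off [vx] and [vy]; the only other possible edge at [v] is [vz],
    which is precolored with [d]. *)
Lemma miss_color k B x y a v z :
  extension_property k -> 1 < k -> a != B -> adj x y -> v != x -> v != y ->
  (forall w, adj v w -> w \in [:: x; y; z]) ->
  exists f, [/\ proper_fun f, avoids f B, f x y = a &
                forall w, adj v w -> f v w != a].
Proof.
move=> ext k1 aB xy vx vy N.
have [d] := fresh_color (s := [:: a; B]) isT; rewrite !inE negb_or => /andP[da dB].
have [//|//|_ _|f [pf fB fxy fvz]] := extend_pair (B := B) (i := (x, y, a))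
   (j := (v, z, d)) ext k1.
  apply: compatI => _; rewrite /same /= ![_ == v]eq_sym (negPf vx) (negPf vy).
  by rewrite ?andbF /= eq_sym.
have [fs fp] := pf; have {}fxy : f x y = a by apply: fxy.
exists f; split=> //.
move=> w vw; move: (N _ vw); rewrite !inE => /or3P[]/eqP e; subst w.
- rewrite fs -fxy; apply: contra_neq vy => E.
  by apply: (fp x); rewrite // adj_sym.
- rewrite fs -fxy (fs x); apply: contra_neq vx => E.
  by apply: (fp y); rewrite // adj_sym.
- by rewrite fvz.
Qed.

(** Otherwise precolor [xz] and [yv] differently. Both [xy] and [xv] meet these two edges, so a
    single color is left for two adjacent edges. *)
Lemma triangle_neighbours k (x y v z : G) :
  extension_property k -> 1 < k -> adj x y -> adj x v -> adj y v -> adj x z ->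
  z \in [:: y; v].
Proof.
move=> ext k1 xy xv yv xz; apply: contraT; rewrite !inE negb_or => /andP[zy zv].
pose c i : 'I_4 := inord i.
have cE i j : i < 4 -> j < 4 -> (c i == c j) = (i == j).
  by move=> i4 j4; rewrite -val_eqE /= !inordK.
have nxy := adj_neq xy; have nxv := adj_neq xv.
have [|||f [[fs fp] fB fxz fvy]] := extend_pair (B := c 0) (i := (x, z, c 1))
   (j := (y, v, c 2)) ext k1; rewrite /= ?cE //.
  move=> _ _; apply: compatI; rewrite /share /= (negPf nxy) (negPf nxv).
  by rewrite (negPf zy) (negPf zv).
have ne u v' w : adj u v' -> adj u w -> v' != w -> f u v' != f u w.
  by move=> ? ?; apply: contra_neq; apply: fp.
have yx : adj y x by rewrite adj_sym.
have vy : adj v y by rewrite adj_sym.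
have vx : adj v x by rewrite adj_sym.
have h1 : f y v != f x y by rewrite (fs x) ne // eq_sym.
have h2 : f y v != f x v by rewrite (fs y) (fs x) ne // eq_sym.
have /uniq_size_ord // : uniq [:: c 0; c 1; c 2; f x y; f x v].
rewrite /= !inE !negb_or !cE //= ![c 0 == _]eq_sym !fB //=.
have := fxz xz; have := fvy yv => /= <- <-.
by rewrite h1 h2 !ne // adj_neq.
Qed.

(* Here the exchange over the edges of color [a] is impossible; [v] becomes a
   target for another base color. *)
Lemma coverable_share k v a i j :
  extension_property k -> 1 < k -> adj i.1.1 i.1.2 -> adj j.1.1 j.1.2 ->
  v \notin [:: i.1.1; i.1.2; j.1.1; j.1.2] -> share i.1 j.1 ->
  i.2 = a -> j.2 = a -> coverable [:: (v, a)] [:: i] [:: j].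
Proof.
case: i j => [[x y] c] [[x' y'] c'] /= ext k1 xy xy' vN sh -> {c}-> {c'}.
have [b] := fresh_color (s := [:: a]) isT; rewrite inE eq_sym => ab.
suff [f [g [pf pg fb gb [fxy gxy fg]]]] : exists f g, [/\ proper_fun f, proper_fun g,
    avoids f b, avoids g b & [/\ f x y = a, g x' y' = a &
      forall w, adj v w -> (f v w == a) = (g v w == a)]].
  have [f' [g' [m [hfit mv _ hf hg]]]] := target1_coloring pf pg fb gb ab fg.
  move: vN; rewrite !inE !negb_or => /and4P[/eqP vx /eqP vy /eqP vx' /eqP vy'].
  exists f', g', m; split=> // i; rewrite inE => /eqP-> //=.
  - by rewrite hf // => -[].
  - by rewrite hg // => -[].
(* A neighbor [w] off both edges lets [vw] be precolored [a] in each copy, so the same edge is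
   exchanged in both. Without one, [a] is made to miss [v] in both copies. *)
have [w /andP[vw wN]|N] := pickP (fun w => adj v w && (w \notin [:: x; y; x'; y'])).
  have vw_ext u u' : v \notin [:: u; u'] -> w \notin [:: u; u'] -> adj u u' ->
      exists f, [/\ proper_fun f, avoids f b, f u u' = a & f v w = a].
    rewrite !inE !negb_or => /andP[vu vu'] /andP[wu wu'] uu'.
    have [//|//||f [pf fb /= fu fw]] := extend_pair (B := b) (i := (u, u', a))
      (j := (v, w, a)) ext k1; last by exists f; rewrite fu ?fw.
    move=> _ _; apply: compatI; rewrite /share /= ![u == _]eq_sym ![u' == _]eq_sym.
    by rewrite (negPf vu) (negPf vu') (negPf wu) (negPf wu').
  move: vN wN; rewrite !inE !negb_or => /and4P[vx vy vx' vy'] /and4P[wx wy wx' wy'].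
  have [|||f [pf fb fxy fw]] := vw_ext x y; rewrite ?inE ?negb_or ?vx ?wx //.
  have [|||g [pg gb gxy gw]] := vw_ext x' y'; rewrite ?inE ?negb_or ?vx' ?wx' //.
  exists f, g; split=> //; split=> // u vu; apply/eqP/eqP => [fu|gu].
    by have <- : w = u by apply: (proj2 pf v) => //; rewrite fu fw.
  by have <- : w = u by apply: (proj2 pg v) => //; rewrite gu gw.
(* The two edges share an end, so together they span at most three vertices, as [miss_color]
   requires. *)
have [z [z' H]] : exists z z', forall w, w \in [:: x; y; x'; y'] ->
    w \in [:: x; y; z] /\ w \in [:: x'; y'; z'].
  case/or4P: sh => /= /eqP e; [exists y', y|exists x', y|exists y', x|exists x', x];
    by move=> w; rewrite !inE e => /or4P[] ->; rewrite ?orbT.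
move: vN; rewrite !inE !negb_or => /and4P[vx vy vx' vy'].
have M w : adj v w -> w \in [:: x; y; x'; y'].
  by move=> vw; have := N w; rewrite vw => /negbFE.
have [w /M/H[]//|f [pf fb fxy fv]] := miss_color (z := z) ext k1 ab xy vx vy.
have [w /M/H[]//|g [pg gb gxy gv]] := miss_color (z := z') ext k1 ab xy' vx' vy'.
exists f, g; split=> //; split=> // w vw.
by rewrite (negPf (fv _ vw)) (negPf (gv _ vw)).
Qed.

(* The exceptional case is a triangle [v x y], which is then a component of [G]:
   there the matching edges at [x] and [y] are recolored by hand. *)
Lemma coverable_same k v a b (x y : G) :
  extension_property k -> 1 < k -> adj x y -> v != x -> v != y -> a != b ->
  coverable [:: (v, a)] [:: (x, y, a)] [:: (x, y, b)].
Proof.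
move=> ext k1 xy vx vy ab.
have [c] := fresh_color (s := [:: a; b]) isT; rewrite !inE negb_or => /andP[ca cb].
have [d] := fresh_color (s := [:: a; b; c]) isT.
rewrite !inE !negb_or => /and3P[da db dc].
have ac : a != c by rewrite eq_sym.
have bc : b != c by rewrite eq_sym.
have nxy := adj_neq xy.
have [/andP[vx1 vy1]|nvxy] := boolP (adj v x && adj v y).
  have nv w : adj v w -> w \in [:: x; y].
    by apply: (triangle_neighbours ext k1).
  have nx w : adj x w -> w \in [:: y; v].
    by apply: (triangle_neighbours ext k1) => //; rewrite adj_sym.
  have ny w : adj y w -> w \in [:: x; v].
    by apply: (triangle_neighbours ext k1) => //; rewrite adj_sym.
  have [||//|f [pf fa /= fxy _]] := extend_pair (B := a) (i := (x, y, b))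
    (j := (x, y, b)) ext k1; rewrite 1?eq_sym //.
    by move=> *; apply: compat_refl.
  have {}fxy := fxy xy; have [fs fp] := pf.
  have Ss : symmetric (fun u w => same (u, w) (x, y)).
    by move=> u w; rewrite /same /= orbC; congr (_ || _); rewrite andbC.
  have Su u w w' : same (u, w) (x, y) -> same (u, w') (x, y) -> w = w'.
    by move=> /sameP[][-> ->] /sameP[][] // e; rewrite e eqxx in nxy.
  have nxv : x != v by rewrite eq_sym.
  have nyv : y != v by rewrite eq_sym.
  have nyx : y != x by rewrite eq_sym.
  have vn : f v x != f v y.
    by apply: contra_neq nxy; apply: fp.
  have vn' : f v y != f v x by rewrite eq_sym.
  have xn : f x y != f v y.
    by rewrite (fs x) (fs v); apply: contra_neq nxv; apply: fp; rewrite adj_sym.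
  have yn : f y x != f v x.
    by rewrite (fs y) (fs v); apply: contra_neq nyv; apply: fp; rewrite // adj_sym.
  (* In the triangle, [b], [f v x] and [f v y] are the three colors other than [a]. The rungs at [x]
     and [y] take the colors of the opposite edges [vy] and [vx], which frees [a] for [xy] in the
     first copy. *)
  exists (fun u w => if same (u, w) (x, y) then a else f u w), f,
    (fun u => if u == x then f v y else if u == y then f v x else a).
  split; [split=> // | move=> i; rewrite inE => /eqP-> /= ..].
  - exact: proper_swap pf fa Ss Su.
  - move=> u w uw /=; case: (eqVneq u x) uw => [->|ux] uw.
      have := nx _ uw; rewrite !inE /same /= eqxx (negPf nxy) orbF.
      case/orP=> /eqP->; rewrite ?eqxx /= ?fa // 1?eq_sym ?xn //.
      by rewrite (negPf vy) (fs x) vn'.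
    case: (eqVneq u y) uw => [->|uy] uw.
      have := ny _ uw; rewrite !inE /same /= eqxx (negPf nyx) /=.
      case/orP=> /eqP->; rewrite ?eqxx /= ?fa // 1?eq_sym ?yn //.
      by rewrite (negPf vx) (fs y) vn.
    by rewrite /same /= (negPf ux) (negPf uy) eq_sym fa.
  - by rewrite (negPf vx) (negPf vy).
  - by rewrite /same /= !eqxx.
  - exact: fxy.
suff [f [g [pf pg fc gc [fxy gxy fg]]]] : exists f g, [/\ proper_fun f, proper_fun g,
    avoids f c, avoids g c & [/\ f x y = a, g x y = b &
      forall w, adj v w -> (f v w == a) = (g v w == a)]].
  have [f' [g' [m [hfit mv _ hf hg]]]] := target1_coloring pf pg fc gc ac fg.
  exists f', g', m; split=> // i; rewrite inE => /eqP-> //=.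
  - by rewrite hf // => -[] e; rewrite e eqxx in vx vy.
  - by rewrite hg // => -[] e; rewrite e eqxx in vx vy.
have [w /andP[vw wN]|N] := pickP (fun w => adj v w && (w \notin [:: x; y])).
  move: wN; rewrite !inE negb_or => /andP[wx wy].
  have vw_ext e : e != c ->
      exists f, [/\ proper_fun f, avoids f c, f x y = e & f v w = a].
    move=> ec; have [//|//||f [pf fb /= fu fw]] := extend_pair (B := c)
      (i := (x, y, e)) (j := (v, w, a)) ext k1; last by exists f; rewrite fu ?fw.
    move=> _ _; apply: compatI; rewrite /share /= ![x == _]eq_sym ![y == _]eq_sym.
    by rewrite (negPf vx) (negPf vy) (negPf wx) (negPf wy).
  have [f [pf fc fxy fw]] := vw_ext _ ac; have [g [pg gc gxy gw]] := vw_ext _ bc.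
  exists f, g; split=> //; split=> // u vu; apply/eqP/eqP => [fu|gu].
    by have <- : w = u by apply: (proj2 pf v) => //; rewrite fu fw.
  by have <- : w = u by apply: (proj2 pg v) => //; rewrite gu gw.
have M w : adj v w -> w \in [:: x; y].
  by move=> vw; have := N w; rewrite vw => /negbFE.
have [|f [pf fc fxy fv]] := miss_color (z := x) ext k1 ac xy vx vy.
  by move=> w /M; rewrite !inE => /orP[] ->; rewrite ?orbT.
suff [g [pg gc gxy gv]] : exists g, [/\ proper_fun g, avoids g c, g x y = b &
    forall w, adj v w -> g v w != a].
  exists f, g; split=> //; split=> // w vw.
  by rewrite (negPf (fv _ vw)) (negPf (gv _ vw)).
(* In the second copy [xy] has color [b] and no longer keeps [a] away from [v]. But [v] has at most
   one neighbor here, so precoloring that one edge suffices. *)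
have [z Mz] : exists z, forall w, adj v w -> w = z.
  move: nvxy; rewrite negb_and; case: (boolP (adj v x)) => /= [_|nvx] nv.
    exists x => w vw; have := M _ vw; rewrite !inE => /orP[]/eqP // e.
    by rewrite -e vw in nv.
  exists y => w vw; have := M _ vw; rewrite !inE => /orP[]/eqP // e.
  by rewrite -e vw in nvx.
have [//|//||g [pg gc /= gxy gz]] := extend_pair (B := c)
   (i := (x, y, b)) (j := (v, z, d)) ext k1.
  move=> _ _; apply: compatI => _; rewrite /same /= [b == _]eq_sym db.
  by rewrite ![_ == v]eq_sym (negPf vx) (negPf vy) ?andbF.
exists g; split=> //; first exact: gxy.
by move=> w vw; rewrite (Mz _ vw) gz // -(Mz _ vw).
Qed.
(** Jointly compatible edges are extended at once with base [a]. A conflict forces [k = 2] and one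
    edge in each copy. If neither has color [a], the copies split; otherwise they lie over one edge
    with different colors, or over two adjacent edges both of color [a]. *)
Lemma coverable_one k v a E0 E1 :
  extension_property k -> k < 3 -> size E0 + size E1 <= k ->
  admissible [:: (v, a)] E0 E1 -> coverable [:: (v, a)] E0 E1.
Proof.
move=> ext k3 Ek adm; have [_ Eadj c0 c1 vE] := adm.
have Ma : {in [:: (v, a)], forall i, i.2 = a} by move=> i; rewrite inE => /eqP->.
have joint : {in E0 ++ E1 &, forall i j, compat i j} -> coverable [:: (v, a)] E0 E1.
  move=> Ec; apply: (swap_coverable ext adm Ma Ec).
  by rewrite (leq_trans (count_size _ _)) // size_cat.
case: E0 E1 Ek adm Eadj c0 c1 vE joint => [|i s] [|j r] Ek adm Eadj c0 c1 vE joint;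
  try exact: joint.
  by rewrite cats0 in joint; apply: joint.
have [k1 s0 r0] : [/\ 1 < k, s = [::] & r = [::]].
  have := leq_trans Ek (k3 : k <= 2); move: Ek; rewrite /= addSn addnS => Ek.
  rewrite (leq_trans _ Ek) // !ltnS leqn0 addn_eq0 => /andP[/nilP-> /nilP->].
  by [].
subst s r.
have iadj : adj i.1.1 i.1.2 by apply: Eadj; rewrite mem_head.
have jadj : adj j.1.1 j.1.2 by apply: Eadj; rewrite !inE eqxx orbT.
have vi : (v == i.1.1) || (v == i.1.2) -> a != i.2.
  by apply: (vE (v, a)); rewrite ?mem_head.
have vj : (v == j.1.1) || (v == j.1.2) -> a != j.2.
  by apply: (vE (v, a)); rewrite ?mem_head // !inE eqxx orbT.
have [ij|/negP nij] := boolP (compat i j); first by apply/joint/compat_pair.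
have [/andP[ia ja]|] := boolP ((i.2 != a) && (j.2 != a)).
  apply: (split_coverable ext adm Ma) => [l||]; rewrite ?(ltnW k1) //.
  by rewrite !inE => /orP[] /eqP->.
move: nij; rewrite negb_and !negbK /compat.
case: ifP => [sij ijc|nsij] H; last first.
  have {H} [sh /eqP ijc] : share i.1 j.1 /\ i.2 == j.2.
    by apply/andP; apply: contraT; rewrite negb_and -implybE => /H.
  rewrite -ijc orbb => /eqP ia; apply: (coverable_share ext k1) => //.
    rewrite ia eqxx in vi; rewrite -ijc ia eqxx in vj.
    by rewrite !inE orbA; apply/norP; split; apply/negP; [move/vi|move/vj].
  by rewrite -ijc.
have side (p q : item) : adj p.1.1 p.1.2 ->
    ((v == p.1.1) || (v == p.1.2) -> a != p.2) ->
    same p.1 q.1 -> p.2 != q.2 -> p.2 = a -> coverable [:: (v, a)] [:: p] [:: q].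
  case: p q => [[x y] c] [[x' y'] d] /= xy vxy s nc ca; subst c.
  have /norP[vx vy] : ~~ ((v == x) || (v == y)).
    by apply/negP=> /vxy; rewrite eqxx.
  have [f [g [m [hfit hm hf hg]]]] := coverable_same ext k1 xy vx vy nc.
  exists f, g, m; split=> // l; rewrite inE => /eqP-> /=.
  have := hg _ (mem_head _ _) => /= <-; have [_ [gs _] _] := hfit.
  by move: s; rewrite same_sym => /sameP[][-> ->]; rewrite // gs.
have nc : i.2 != j.2 by apply/negP.
case/orP: H => /eqP; first exact: side.
move=> ja; apply: coverableC; apply: side; rewrite // 1?same_sym // eq_sym //.
Qed.

(** * Three prescribed rungs *)

(** With base [a] the only target is [(w, b)]; precoloring [wu] and [wv] keeps the exchange away
    from [u] and [v]. If [u = v], the two items name one edge and must have the same color. *)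
Lemma coverable_two_one u v w a b :
  extension_property 2 -> a != b -> u != w -> v != w ->
  coverable [:: (u, a); (v, a); (w, b)] [::] [::].
Proof.
move=> ext ab uw vw; have ba : b != a by rewrite eq_sym.
have [c] := fresh_color (s := [:: a; b]) isT; rewrite !inE negb_or => /andP[ca cb].
have [d] := fresh_color (s := [:: a; b; c]) isT.
rewrite !inE !negb_or => /and3P[da db dc].
have [f [pf fa fu fv]] : exists f, [/\ proper_fun f, avoids f a,
    adj w u -> f w u != b & adj w v -> f w v != b].
  have [//|//||f [pf fa /= fu fv]] := extend_pair (B := a) (i := (w, u, c))
     (j := (w, v, if u == v then c else d)) ext isT; rewrite /=.
  - by case: ifP.
  - move=> _ _; case: eqP => [->|/eqP nuv]; first exact: compat_refl.
    apply: compatI => _; rewrite /same /= eqxx (negPf nuv) /= [c == d]eq_sym dc.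
    by rewrite andbT negb_and [w == v]eq_sym vw.
  exists f; split=> // [/fu -> //|/fv ->]; by case: ifP.
have [//|f' [g' [m [hfit mw ma _ _]]]] := target1_coloring (q := w) pf pf fa fa ba.
exists f', g', m; split=> // i; rewrite !inE => /or3P[] /eqP-> //=; exact: ma.
Qed.

(* With base color [a] at [u], the exchanges at the targets [(v, b)] and
   [(w, c)] are possible and affect neither each other nor [u]. *)
Definition separable u a v b w c : Prop :=
  exists f, [/\ proper_fun f, avoids f a,
    [/\ adj v u -> f v u != b, adj w u -> f w u != c &
        adj v w -> f v w \notin [:: b; c]] &
    forall z, adj v z -> adj w z -> f v z = b -> f w z != c].

Lemma separableC u a v b w c : separable u a v b w c -> separable u a w c v b.
Proof.
case=> f [pf fa [vu wu vw] nz]; exists f; split=> //.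
  split=> // wv; rewrite (proj1 pf) !inE orbC; move: vw; rewrite !inE; apply.
  by rewrite adj_sym.
by move=> z wz vz; apply: contra_eq_neq => /(nz _ vz wz).
Qed.

Lemma separable_covers u a v b w c :
  a != b -> a != c -> u != v -> u != w -> v != w -> separable u a v b w c ->
  coverable [:: (u, a); (v, b); (w, c)] [::] [::].
Proof.
move=> ab ac uv uw vw [f [pf fa [vu wu vwbc] nz]]; have [fs _] := pf.
have wvbc : adj w v -> f w v \notin [:: b; c] by rewrite adj_sym fs.
have [||||| f' [g' [m [hfit hT hB _ _]]]] :=
  target_coloring (T := [:: (v, b); (w, c)]) pf pf fa fa.
- move=> s t; rewrite !inE => /orP[]/eqP-> /orP[]/eqP-> //= e;
    by rewrite e eqxx in vw.
- by move=> t; rewrite !inE => /orP[]/eqP->; rewrite eq_sym.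
- by [].
- move=> s t; rewrite !inE => /orP[]/eqP-> /orP[]/eqP->; rewrite ?adj_irrefl //=.
    by move/vwbc; rewrite !inE => /norP[].
  by move/wvbc; rewrite !inE => /norP[].
- move=> s t; rewrite !inE => /orP[]/eqP-> /orP[]/eqP-> y /=; rewrite ?eqxx //.
    by move=> _; apply: nz.
  by move=> _ wy vy fc; apply/eqP => /(nz _ vy wy); rewrite fc eqxx.
exists f', g', m; split=> // i; rewrite inE => /predU1P[->|/hT //] /=.
by apply: hB => t; rewrite !inE => /orP[]/eqP->; rewrite eq_sym.
Qed.

(** Two precolored edges suffice to keep [b] off all edges at [v], so nothing is exchanged there. If
    [vu] is an edge, giving it [c] also keeps [c] off [wu]. *)
Lemma separable_dominated u a v b w c :
  extension_property 2 -> uniq [:: a; b; c] -> uniq [:: u; v; w] ->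
  (forall y, adj v y -> y \in [:: u; w]) -> separable u a v b w c.
Proof.
move=> ext; rewrite /= !inE !negb_or !andbT => /andP[/andP[ab ac] bc].
move=> /andP[/andP[uv uw] vw] N.
have [d] := fresh_color (s := [:: a; b; c]) isT.
rewrite !inE !negb_or => /and3P[da db dc].
have [vu|nvu] := boolP (adj v u).
  have [|//||f [pf fa /= fu fw]] := extend_pair (B := a) (i := (v, u, c))
     (j := (v, w, d)) ext isT; rewrite 1?eq_sym //=.
    move=> _ _; apply: compatI => _; rewrite /same /= eqxx (negPf uw) [c == d]eq_sym dc.
    by rewrite andbT negb_and vw.
  have [fs fp] := pf; exists f; split=> //.
    split=> [||/fw ->].
    - by rewrite fu // eq_sym.
    - move=> wu; rewrite fs -(fu vu) (fs v); apply: contra_neq vw => E.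
      by apply: (fp u); rewrite // adj_sym.
    - by rewrite !inE negb_or db.
  move=> z /[dup] /N; rewrite !inE => /orP[]/eqP-> vz wz.
    by rewrite fu // => e; rewrite e eqxx in bc.
  by rewrite adj_irrefl in wz.
have [//|||f [pf fa /= fw fu]] := extend_pair (B := a) (i := (v, w, d))
   (j := (w, u, b)) ext isT; rewrite 1?eq_sym //=.
  move=> _ _; apply: compatI => _; rewrite /same /= db andbT.
  by rewrite [w == u]eq_sym (negPf uw) (negPf vw) [v == u]eq_sym (negPf uv).
exists f; split=> //.
  split=> [|/fu -> //|/fw ->]; first by rewrite (negPf nvu).
  by rewrite !inE negb_or db.
move=> z /[dup] /N; rewrite !inE => /orP[]/eqP-> vz wz.
  by rewrite vz in nvu.
by rewrite adj_irrefl in wz.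
Qed.

(** If [v] and [w] have distinct neighbors outside the three rungs, the exchanges are forced along
    these two disjoint edges. If one of [v], [w] has no outside neighbor, [separable_dominated]
    applies. What remains is a single outside neighbor [x], common to both. *)
Lemma separable_three u a v b w c :
  extension_property 2 -> uniq [:: a; b; c] -> uniq [:: u; v; w] ->
  separable u a v b w c.
Proof.
move=> ext Uabc Uuvw.
have dis (T : eqType) (x y z : T) : uniq [:: x; y; z] -> [/\ x != y, x != z & y != z].
  by rewrite /= !inE negb_or andbT => /andP[/andP[]].
have [ab ac bc] := dis _ _ _ _ Uabc; have [uv uw vw] := dis _ _ _ _ Uuvw.
have [ba ca cb] : [/\ b != a, c != a & c != b] by rewrite !(eq_sym _ a) (eq_sym c).
have [vu wu wv] : [/\ v != u, w != u & w != v] by rewrite !(eq_sym _ u) (eq_sym w).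
have [x /andP[vx xN]|N] := pickP (fun x => adj v x && (x \notin [:: u; w])); last first.
  apply: separable_dominated => // y vy.
  by have := N y; rewrite vy => /negbFE.
have [y0 /andP[wy0 y0N]|N] := pickP (fun y => adj w y && (y \notin [:: u; v])); last first.
  apply: separableC; apply: separable_dominated => // [||y wy].
  - by rewrite /= !inE negb_or ab ac cb.
  - by rewrite /= !inE negb_or uv uw wv.
  - by have := N y; rewrite wy => /negbFE.
have distinct x' y' : adj v x' -> adj w y' -> x' \notin [:: u; w] ->
    y' \notin [:: u; v] -> x' != y' -> separable u a v b w c.
  rewrite !inE !negb_or => vx' wy' /andP[x'u x'w] /andP[y'u y'v] x'y'.
  have [//|//||f [pf fa /= fx fy]] := extend_pair (B := a) (i := (v, x', b))
     (j := (w, y', c)) ext isT.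
    move=> _ _; apply: compatI; rewrite /share /= (negPf vw) (negPf x'w).
    by rewrite [v == y']eq_sym (negPf y'v) (negPf x'y').
  have {}fx := fx vx'; have {}fy := fy wy'.
  have fvb z : adj v z -> f v z = b -> z = x'.
    by move=> vz e; apply: (proj2 pf v); rewrite // fx e.
  have fwc z : adj w z -> f w z = c -> z = y'.
    by move=> wz e; apply: (proj2 pf w); rewrite // fy e.
  exists f; split=> //.
    split=> [vu'|wu'|vw']; last rewrite !inE negb_or.
    - by apply: contra_neqN x'u => /eqP/(fvb _ vu') ->.
    - by apply: contra_neqN y'u => /eqP/(fwc _ wu') ->.
    apply/andP; split; first by apply: contra_neqN x'w => /eqP/(fvb _ vw') ->.
    apply: contra_neqN y'v => /eqP; rewrite (proj1 pf) => /fwc <- //.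
    by rewrite adj_sym.
  move=> z vz wz /(fvb _ vz) ez; apply: contra_neqN x'y' => /eqP/(fwc _ wz).
  by rewrite -ez => ->.
have [xy|nxy] := eqVneq x y0; last exact: (distinct x y0).
subst y0; have wx := wy0.
move: xN y0N; rewrite !inE !negb_or => /andP[xu xw] /andP[_ xv].
have [z /andP[vz]|Nv] := pickP (fun z => adj v z && (z \notin [:: u; w; x])).
  rewrite !inE !negb_or => /and3P[zu zw zx].
  by apply: (distinct z x); rewrite // !inE negb_or ?zu ?zw ?xu ?xv.
have [z /andP[wz]|Nw] := pickP (fun z => adj w z && (z \notin [:: u; v; x])).
  rewrite !inE !negb_or => /and3P[zu zv zx].
  by apply: (distinct x z); rewrite // ?inE ?negb_or ?zu ?zv ?xu ?xw // eq_sym.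
have {}Nv z : adj v z -> z \in [:: u; w; x].
  by move=> vz; have := Nv z; rewrite vz => /negbFE.
have {}Nw z : adj w z -> z \in [:: u; v; x].
  by move=> wz; have := Nw z; rewrite wz => /negbFE.
have [d] := fresh_color (s := [:: a; b; c]) isT.
rewrite !inE !negb_or => /and3P[da db dc].
have [ux wx'] : u != x /\ w != x by rewrite ![_ == x]eq_sym.
have [bd cd] : b != d /\ c != d by rewrite ![_ == d]eq_sym.
(* In each remaining case the precoloring keeps [c] off all edges at [w], so only [v] may exchange.
   If [wv] is an edge, [v], [w], [x] form a triangle, which excludes edges to [u]. *)
have [awv|nwv] := boolP (adj w v).
  have triangle_w : ~~ adj w u.
    apply/negP=> /(triangle_neighbours ext isT awv wx vx).
    by rewrite !inE (negPf uv) (negPf ux).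
  have triangle_v : ~~ adj v u.
    have avw : adj v w by rewrite adj_sym.
    apply/negP=> /(triangle_neighbours ext isT avw vx wx).
    by rewrite !inE (negPf uw) (negPf ux).
  have [//|//||f [pf fa /= fwx fwv]] := extend_pair (B := a) (i := (w, x, b))
     (j := (w, v, d)) ext isT.
    move=> _ _; apply: compatI => _.
    by rewrite /same /= eqxx (negPf xv) [x == w]eq_sym (negPf wx') bd !andbF.
  exists f; split=> //.
    split=> [vu'|wu'|_]; first by rewrite vu' in triangle_v.
      by rewrite wu' in triangle_w.
    by rewrite (proj1 pf) fwv // !inE negb_or db dc.
  move=> z _ /[dup] /Nw; rewrite !inE => /or3P[] /eqP-> wz _.
  - by rewrite wz in triangle_w.
  - by rewrite fwv.
  - by rewrite fwx.
have nvw : ~~ adj v w by rewrite adj_sym.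
have [awu|nwu] := boolP (adj w u).
  have [//|//||f [pf fa /= fwx fwu]] := extend_pair (B := a) (i := (w, x, d))
     (j := (w, u, b)) ext isT.
    move=> _ _; apply: compatI => _.
    by rewrite /same /= eqxx (negPf xu) [x == w]eq_sym (negPf wx') db !andbF.
  have [fs fp] := pf; exists f; split=> //.
    split=> [vu'|_|vw']; last by rewrite vw' in nvw.
      rewrite fs -(fwu awu) (fs w); apply: contra_neq vw.
      by apply: fp; rewrite adj_sym.
    by rewrite fwu.
  move=> z vz /[dup] /Nw; rewrite !inE => /or3P[] /eqP-> wz _.
  - by rewrite fwu.
  - by rewrite wz in nwv.
  - by rewrite fwx.
have [//|//||f [pf fa /= fvx fwx]] := extend_pair (B := a) (i := (v, x, b))
   (j := (w, x, d)) ext isT.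
  move=> _ _; apply: compatI => _.
  by rewrite /same /= (negPf vw) [v == x]eq_sym (negPf xv) bd.
have [fs fp] := pf; exists f; split=> //.
  split=> [vu'|wu'|vw']; last by rewrite vw' in nvw.
    by rewrite -(fvx vx); apply: contra_neq ux; apply: fp.
  by rewrite wu' in nwu.
move=> z vz /[dup] /Nw; rewrite !inE => /or3P[] /eqP-> wz _.
- by rewrite wz in nwu.
- by rewrite wz in nwv.
- by rewrite fwx.
Qed.

(** * Cases by the number of prescribed rungs *)

Lemma coverable_sub Ms Ms' E0 E1 :
  {subset Ms <= Ms'} -> coverable Ms' E0 E1 -> coverable Ms E0 E1.
Proof.
by move=> sM [f [g [m [hfit hM h0 h1]]]]; exists f, g, m; split=> // i /sM /hM.
Qed.

Lemma coverable_zero k E0 E1 :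
  extension_property k -> k < 3 -> size E0 + size E1 <= k + 1 ->
  admissible [::] E0 E1 -> coverable [::] E0 E1.
Proof.
move=> ext k3.
have single E : size E <= k + 1 -> admissible [::] E [::] -> coverable [::] E [::].
  move=> Ek adm; have [_ _ c0 _ _] := adm.
  (* Taking the color of the first edge as base leaves at most [k] edges of other colors. *)
  apply: (swap_coverable (a := if E is i :: _ then i.2 else ord0) ext adm) => //.
    by rewrite cats0.
  case: E Ek {adm c0} => //= i s; rewrite addn1 ltnS cats0 eqxx add0n.
  exact/leq_trans/count_size.
case: E0 E1 => [|i E0] [|j E1] Ek adm; try exact: single.
- by apply/coverableC/single => //; apply: admissibleC.
- by apply: single; rewrite // -[size _]addn0.
have [|a aN] := fresh_color (s := [seq l.2 | l <- (i :: E0) ++ j :: E1]).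
  by rewrite size_map size_cat (leq_ltn_trans Ek) // addn1.
apply: (split_coverable (a := a) ext adm) => //.
- by move=> l lE; apply: contraNneq aN => <-; apply: map_f.
- by rewrite -ltnS -(addn1 k) (leq_trans _ Ek) // [size (j :: _)]/= addnS ltnS leq_addr.
- by rewrite -ltnS -(addn1 k) (leq_trans _ Ek) // [size (i :: _)]/= addSn ltnS leq_addl.
Qed.

(** At most one edge is prescribed besides the rungs. If [b] and [c] differ, at least one of them is
    not its color and can serve as base. *)
Lemma coverable_pair k p b q c E0 E1 :
  extension_property k -> k < 3 -> 1 + (size E0 + size E1) <= k ->
  admissible [:: (p, b); (q, c)] E0 E1 -> coverable [:: (p, b); (q, c)] E0 E1.
Proof.
move=> ext k3 Ek adm.
have E1le : size E0 + size E1 <= 1 by exact: leq_trans Ek k3.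
have joint : {in E0 ++ E1 &, forall i j, compat i j}.
  case: (E0 ++ E1) (size_cat E0 E1) => [|l []] //=.
    by move=> _ i j; rewrite !inE => /eqP-> /eqP->; apply: compat_refl.
  by move=> l' r e; rewrite -e in E1le.
have [bc|bc] := eqVneq b c.
  subst c; apply: (swap_coverable (a := b) ext adm) => //.
    by move=> i; rewrite !inE => /orP[]/eqP->.
  by rewrite (leq_trans (count_size _ _)) // size_cat (leq_trans _ Ek) // leqnSn.
have pq : p != q.
  have [h _ _ _ _] := adm; apply: contra_neq bc => pq.
  by apply: (h (p, b) (q, c)); rewrite ?inE ?eqxx ?orbT.
have single E : 1 + size E <= k -> size E <= 1 -> admissible [:: (p, b); (q, c)] E [::] ->
    coverable [:: (p, b); (q, c)] E [::].
  move=> {}Ek El [_ Eadj _ _ ME]; rewrite cats0 in Eadj ME.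
  have [/hasP[i iE /eqP ib]|/hasPn nb] := boolP (has (fun i => i.2 == b) E).
    apply: (@coverable_sub _ [:: (q, c); (p, b)]).
      by move=> l; rewrite !inE orbC.
    apply: (coverable_two ext) => // [|||j jE].
    - by rewrite eq_sym.
    - by rewrite eq_sym.
    - case: E El iE {Ek Eadj ME} => [|l []] //= _; rewrite inE => /eqP il j.
      by rewrite inE => /eqP->; rewrite -il ib.
    - by apply: (ME (p, b)); rewrite ?mem_head.
  apply: (coverable_two ext) => // j jE.
  by apply: (ME (q, c)); rewrite // !inE eqxx orbT.
case: E0 E1 Ek E1le adm {joint} => [|i E0] [|j E1] Ek El adm; try exact: single.
- by apply/coverableC/single => //; apply: admissibleC.
- by rewrite addn0 in Ek El; apply: single.
- by move: El; rewrite /= addSn addnS.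
Qed.

(** A repeated color is taken as base and leaves at most one target; if all three differ, base [a]
    leaves two. *)
Lemma coverable_triple u a v b w c :
  extension_property 2 -> admissible [:: (u, a); (v, b); (w, c)] [::] [::] ->
  coverable [:: (u, a); (v, b); (w, c)] [::] [::].
Proof.
move=> ext adm; have [h _ _ _ _] := adm.
have uv : a != b -> u != v.
  by apply: contra_neq => e; apply: (h (u, a) (v, b)); rewrite ?inE ?eqxx ?orbT.
have uw : a != c -> u != w.
  by apply: contra_neq => e; apply: (h (u, a) (w, c)); rewrite ?inE ?eqxx ?orbT.
have vw : b != c -> v != w.
  by apply: contra_neq => e; apply: (h (v, b) (w, c)); rewrite ?inE ?eqxx ?orbT.
have [ab|ab] := eqVneq a b.
  subst b; have [ac|ac] := eqVneq a c.
    subst c; apply: (swap_coverable (a := a) ext adm) => //.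
    by move=> i; rewrite !inE => /or3P[]/eqP->.
  by apply: coverable_two_one => //; auto.
have [ac|ac] := eqVneq a c.
  subst c; apply: (@coverable_sub _ [:: (u, a); (w, a); (v, b)]).
    by move=> i; rewrite !inE [(i == (w, a)) || _]orbC.
  by apply: coverable_two_one => //; [exact: uv|rewrite eq_sym vw // eq_sym].
have [bc|bc] := eqVneq b c.
  subst c; apply: (@coverable_sub _ [:: (v, b); (w, b); (u, a)]).
    by move=> i; rewrite !inE => /or3P[] ->; rewrite ?orbT.
  by apply: coverable_two_one => //; rewrite eq_sym; auto.
have Uabc : uniq [:: a; b; c] by rewrite /= !inE negb_or ab ac bc.
have Uuvw : uniq [:: u; v; w] by rewrite /= !inE negb_or uv ?uw ?vw.
by apply: separable_covers; auto; apply: separable_three.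
Qed.

Lemma admissible_coverable k Ms E0 E1 :
  extension_property k -> k < 3 -> size Ms + (size E0 + size E1) <= k + 1 ->
  admissible Ms E0 E1 -> coverable Ms E0 E1.
Proof.
move=> ext k3; rewrite addn1; case: Ms => [|[v a] [|[w b] [|[u c] Ms]]] /= Ek.
- by apply: (coverable_zero ext); rewrite // addn1.
- exact: (coverable_one ext).
- exact: (coverable_pair ext).
have Ek2 : size Ms + (size E0 + size E1) <= 0.
  by have := leq_trans Ek k3.
have kge2 : 2 <= k by rewrite -ltnS (leq_trans _ Ek) // !addSn.
have {k3}k2 : k = 2 by apply/eqP; rewrite eqn_leq kge2 andbT -ltnS.
subst k; move: Ek2; rewrite leqn0 !addn_eq0 => /and3P[/nilP-> /nilP-> /nilP->].
exact: coverable_triple.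
Qed.

End Items.

(** * Translation to edge colorings of the prism *)

Section Prism.
Variable G : sgraph.
Notation item := (G * G * 'I_4)%type.
Notation prism := (cart_prod G (complete_graph 2)).

Definition rung (v : G) : {set prism} :=
  [set ((v, ord0) : prism); ((v, ord_max) : prism)].

Definition layer (b : 'I_2) (x y : G) : {set prism} :=
  [set ((x, b) : prism); ((y, b) : prism)].

Lemma layer_eq b x y x' y' : (layer b x y == layer b x' y') = same (x, y) (x', y').
Proof. by rewrite pair_setE !xpair_eqE eqxx !andbT. Qed.

Lemma layer_disjoint b x y x' y' :
  [disjoint layer b x y & layer b x' y'] = ~~ share (x, y) (x', y').
Proof. by rewrite pair_set_disjoint !xpair_eqE eqxx !andbT. Qed.

Lemma ord2P (i : 'I_2) : i = ord0 \/ i = ord_max.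
Proof. by case: i => [[|[]]] // h; [left|right]; apply: val_inj. Qed.

Lemma prism_edge (p q : prism) : adj p q ->
  [set p; q] = rung p.1 /\ p.1 = q.1 \/
  [/\ [set p; q] = layer p.2 p.1 q.1, p.2 = q.2 & adj p.1 q.1].
Proof.
case: p q => [x i] [y j] /= /orP[]/andP[/eqP /= e xy]; subst; last by right.
left; split=> //; move: xy; rewrite /adj /= /complete_adj /rung.
by case: (ord2P i) => ->; case: (ord2P j) => ->; rewrite ?eqxx // setUC.
Qed.

Lemma prism_coloring (f g : G -> G -> 'I_4) m : fits f g m ->
  exists h : prism -> prism -> 'I_4, [/\ proper_fun h,
    forall v, h (v, ord0) (v, ord_max) = m v,
    forall x y, adj x y -> h (x, ord0) (y, ord0) = f x y &
    forall x y, adj x y -> h (x, ord_max) (y, ord_max) = g x y].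
Proof.
case=> -[fs fp] [gs gp] hm.
(* Both second coordinates are tested so that the function is symmetric also on non-adjacent
   pairs. *)
exists (fun p q : prism => if p.1 == q.1 then m p.1 else
  if (p.2 == ord0) && (q.2 == ord0) then f p.1 q.1 else g p.1 q.1); split=> /=.
- split=> [p q|p q r pq pr].
    rewrite [q.1 == _]eq_sym [(q.2 == _) && _]andbC fs gs.
    by case: eqP => // ->.
  case: p q r pq pr => [x i] [y j] [z l] /= xy xz.
  move: xy xz; rewrite /cart_adj /= /complete_adj.
  case: (eqVneq x y) => [<-|nxy] /=; case: (eqVneq x z) => [<-|nxz] /=.
  - rewrite !adj_irrefl !andbF !orbF => ij il _; congr (_, _); move: ij il.
    by case: (ord2P i) => ->; case: (ord2P j) => ->; case: (ord2P l) => ->.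
  - move=> _ /andP[_ xz]; have [mf mg] := hm _ _ xz.
    by case: ifP => _ /eqP; rewrite ?(negPf mf) ?(negPf mg).
  - move=> /andP[_ xy] _; have [mf mg] := hm _ _ xy.
    by case: ifP => _ /eqP; rewrite eq_sym ?(negPf mf) ?(negPf mg).
  - move=> /andP[/eqP <- xy] /andP[/eqP <- xz]; rewrite andbb.
    by case: ifP => _ e; congr (_, _); [apply: fp e|apply: gp e].
- by move=> v; rewrite eqxx.
- by move=> x y /adj_neq/negPf ->.
- by move=> x y /adj_neq/negPf ->.
Qed.

(** Total length is preserved, so the bound on the number of colored edges becomes a bound on the
    three lists. *)
Lemma classify_edges (phi : {ffun {set prism} -> option 'I_4}) s :
  colored phi \subset edges prism -> {subset s <= colored phi} ->
  exists Ms E0 E1, [/\ size Ms + (size E0 + size E1) = size s,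
    {in Ms, forall i, phi (rung i.1) = Some i.2},
    {in E0, forall i, adj i.1.1 i.1.2 /\ phi (layer ord0 i.1.1 i.1.2) = Some i.2},
    {in E1, forall i, adj i.1.1 i.1.2 /\ phi (layer ord_max i.1.1 i.1.2) = Some i.2} &
    {in s, forall e, [\/ exists2 i, i \in Ms & e = rung i.1,
      exists2 i, i \in E0 & e = layer ord0 i.1.1 i.1.2 |
      exists2 i, i \in E1 & e = layer ord_max i.1.1 i.1.2]}].
Proof.
move=> /subsetP dom; elim: s => [|e s IH] sub; first by exists [::], [::], [::].
have [e' e's|Ms [E0 [E1 [sz hM h0 h1 hs]]]] := IH.
  by apply: sub; rewrite inE e's orbT.
have /[dup] /dom /edgesP[p [q [pq eE]]] := sub _ (mem_head _ _).
rewrite inE; case phie: (phi e) => [c|] // _.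
have mono Ms' E0' E1' : {subset Ms <= Ms'} -> {subset E0 <= E0'} -> {subset E1 <= E1'} ->
    {in s, forall e, [\/ exists2 i, i \in Ms' & e = rung i.1,
      exists2 i, i \in E0' & e = layer ord0 i.1.1 i.1.2 |
      exists2 i, i \in E1' & e = layer ord_max i.1.1 i.1.2]}.
  move=> sM s0 s1 d ds.
  by case: (hs _ ds) => -[i iI ->]; [apply: Or31|apply: Or32|apply: Or33];
    exists i; rewrite // ?sM ?s0 ?s1.
have [[er _]|[el _ xy]] := prism_edge pq.
  exists ((p.1, c) :: Ms), E0, E1; split=> //=; first by rewrite -sz.
    by move=> i; rewrite inE => /predU1P[-> /=|/hM //]; rewrite -er -eE.
  move=> d; rewrite inE => /predU1P[->|]; last first.
    by apply: mono => // i iI; rewrite inE iI orbT.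
  by apply: Or31; exists (p.1, c); rewrite ?mem_head // eE er.
case: (ord2P p.2) => p2; rewrite p2 in el.
  exists Ms, ((p.1, q.1, c) :: E0), E1; split=> //=; first by rewrite -sz addnS.
    by move=> i; rewrite inE => /predU1P[-> /=|/h0 //]; rewrite -el -eE.
  move=> d; rewrite inE => /predU1P[->|]; last first.
    by apply: mono => // i iI; rewrite inE iI orbT.
  by apply: Or32; exists (p.1, q.1, c); rewrite ?mem_head // eE el.
exists Ms, E0, ((p.1, q.1, c) :: E1); split=> //=; first by rewrite -sz !addnS.
  by move=> i; rewrite inE => /predU1P[-> /=|/h1 //]; rewrite -el -eE.
move=> d; rewrite inE => /predU1P[->|]; last first.
  by apply: mono => // i iI; rewrite inE iI orbT.
by apply: Or33; exists (p.1, q.1, c); rewrite ?mem_head // eE el.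
Qed.

Lemma proper_color (H : sgraph) t (phi : {ffun {set H} -> option 'I_t}) e e' c :
  partial_edge_coloring phi -> phi e = Some c -> phi e' = Some c ->
  ~~ [disjoint e & e'] -> e = e'.
Proof.
case/andP=> _ /forall_inP pr ec ec' nd.
have /pr/forall_inP/(_ e') : e \in colored phi by rewrite inE ec.
rewrite inE ec' ec nd andbT eqxx /= => /(_ isT).
by rewrite implybF negbK => /eqP.
Qed.

Lemma rung_layer_disjoint v b x y :
  [disjoint rung v & layer b x y] = (v != x) && (v != y).
Proof.
rewrite pair_set_disjoint !xpair_eqE; case: (ord2P b) => -> /=;
  by rewrite ?eqxx ?andbT ?andbF ?orbF !negb_or.
Qed.

Lemma rung_neq_layer v b x y : rung v != layer b x y.
Proof.
rewrite pair_setE !xpair_eqE; case: (ord2P b) => -> /=; by rewrite ?andbF.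
Qed.

End Prism.

Theorem theorem4p5 (G : sgraph) (k : nat) :
  max_degree G = 3 ->
  chromatic_index G = 3 ->
  k < 3 ->
  (forall phi : {ffun {set G} -> option 'I_3},
     partial_edge_coloring phi -> #|colored phi| <= k -> extendable phi) ->
  forall phi : {ffun {set cart_prod G (complete_graph 2)} -> option 'I_4},
    partial_edge_coloring phi -> #|colored phi| <= k + 1 -> extendable phi.
Proof.
move=> _ _ k3 /extension_propertyI ext phi pphi phik.
have dom : colored phi \subset edges _ by case/andP: pphi.
have [e|Ms [E0 [E1 [sz hM h0 h1 hs]]]] := classify_edges (s := enum (colored phi)) dom.
  by rewrite mem_enum.
have layer_adm b E : {in E, forall i, adj i.1.1 i.1.2 /\
    phi (layer b i.1.1 i.1.2) = Some i.2} -> {in E &, forall i j, compat i j}.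
  move=> hE i j /hE[_ hi] /hE[_ hj]; rewrite /compat.
  case: (i) (j) hi hj => [[x y] c] [[x' y'] d] /= hi hj.
  rewrite -(layer_eq b); case: eqP => [e|ne].
    by rewrite e hj in hi; case: hi => ->.
  apply/implyP=> sh; apply/eqP=> cd; rewrite cd in hi; apply: ne.
  by apply: proper_color pphi hi hj _; rewrite layer_disjoint negbK.
have adm : admissible Ms E0 E1.
  split; [| |exact: layer_adm h0|exact: layer_adm h1|].
  - move=> i j /hM hi /hM hj e; rewrite e hj in hi; by case: hi.
  - by move=> i; rewrite mem_cat => /orP[/h0|/h1] [].
  move=> i j /hM hi jE ij.
  have [b hj] : exists b, phi (layer b j.1.1 j.1.2) = Some j.2.
    by move: jE; rewrite mem_cat => /orP[/h0|/h1] [_ ?]; eexists; eassumption.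
  apply/eqP=> e; rewrite e in hi.
  have /eqP : rung i.1 = layer b j.1.1 j.1.2.
    by apply: proper_color pphi hi hj _; rewrite rung_layer_disjoint -negb_or negbK.
  by rewrite (negPf (rung_neq_layer _ _ _ _)).
have [|f [g [m [hfit hm hf hg]]]] := admissible_coverable ext k3 _ adm.
  by rewrite sz -cardE.
have [h [ph hr hl0 hl1]] := prism_coloring hfit; have [hsym _] := ph.
apply: (extendable_of_proper_fun ph dom) => p q c phic.
have : [set p; q] \in colored phi by rewrite inE phic.
have pair_h (p' q' : cart_prod G (complete_graph 2)) :
    [set p; q] = [set p'; q'] -> h p q = h p' q'.
  by move/eqP; rewrite pair_setE => /orP[]/andP[/eqP-> /eqP->].
rewrite -mem_enum => /hs[] [i iI e].
- by rewrite (pair_h _ _ e) hr hm //; move: (hM _ iI); rewrite -e phic => -[].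
- have [ai] := h0 _ iI; rewrite -e phic => -[->].
  by rewrite (pair_h _ _ e) hl0 // hf.
- have [ai] := h1 _ iI; rewrite -e phic => -[->].
  by rewrite (pair_h _ _ e) hl1 // hg.
Qed.
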